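(* For each monotone increasing function $\beta:(0,1] \rightarrow (0,1]$, each $\epsilon>0$, and each graph $H$, there is $\delta=\delta(\beta,\epsilon,H)>0$ such that every $(\beta,\delta)$-dense $H$-free graph on $n$ vertices contains an induced subgraph on at least $\delta n$ vertices with edge density at least $1-\epsilon$.
   Context: The edge density of a graph on $v$ vertices with $e$ edges is $e/\binom{v}{2}$. For $\delta \in (0,1]$ and a monotone increasing function $\beta:(0,1]\to(0,1]$, a graph on $N$ vertices is $(\beta,\delta)$-dense if for every $\sigma \geq \delta$, every induced subgraph on $\sigma N$ vertices has edge density at least $\beta(\sigma)$. A graph is $H$-free if it does not contain $H$ as an induced subgraph. *)

(* Defs.v *)
From HB Require Import structures.
From mathcomp Require Import all_boot all_order all_algebra.
From mathcomp Require Import reals.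

Set Implicit Arguments.
Unset Strict Implicit.
Unset Printing Implicit Defensive.

Import Order.TTheory GRing.Theory Num.Theory.
Local Open Scope ring_scope.

Record sgraph := SGraph {
  vertex :> finType;
  adj : rel vertex;
  adj_sym : symmetric adj;
  adj_irrefl : irreflexive adj }.

Definition edges (G : sgraph) : {set {set G}} :=
  [set e : {set G} | [exists x, [exists y, adj x y && (e == [set x; y])]]].

Section Induced.
Variables (G : sgraph) (S : {set G}).

Definition induced_adj : rel {x : G | x \in S} :=
  fun x y => adj (val x) (val y).

Fact induced_sym : symmetric induced_adj.
Proof. by move=> x y; apply: adj_sym. Qed.

Fact induced_irrefl : irreflexive induced_adj.
Proof. by move=> x; apply: adj_irrefl. Qed.

Definition induced : sgraph := SGraph induced_sym induced_irrefl.
End Induced.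

Definition isomorphic (G H : sgraph) : Prop :=
  exists2 f : G -> H, bijective f & forall x y, adj (f x) (f y) = adj x y.

Definition induced_free (H G : sgraph) : Prop :=
  forall S : {set G}, ~ isomorphic (induced S) H.

(* Meaningful only when [1 < #|G|]: on fewer vertices this is [0 / 0], which
   evaluates to [0].  Uses of the density below are guarded accordingly. *)
Definition edge_density (R : realType) (G : sgraph) : R :=
  #|edges G|%:R / 'C(#|G|, 2)%:R.

(* Monotone (in the weak sense) functions from (0,1] to (0,1]; values outside
   (0,1] are irrelevant. *)
Definition density_function (R : realType) (beta : R -> R) : Prop :=
  {in `]0, 1], forall s, beta s \in `]0, 1]} /\
  {in `]0, 1] &, {homo beta : s t / s <= t}}.

(* No rounding: only those [sigma] for which [sigma * #|G|] is an integer
   impose a condition. *)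
Definition dense (R : realType) (beta : R -> R) (delta : R) (G : sgraph) : Prop :=
  forall sigma : R, delta <= sigma <= 1 ->
  forall S : {set G}, (1 < #|S|)%N -> #|S|%:R = sigma * #|G|%:R ->
  beta sigma <= edge_density R (induced S).

(* Main.v *)
Require Import Defs.
From HB Require Import structures.
From mathcomp Require Import all_boot all_order all_algebra.
From mathcomp Require Import reals ring lra.

Set Implicit Arguments.
Unset Strict Implicit.
Unset Printing Implicit Defensive.

Import Order.TTheory GRing.Theory Num.Theory.
Local Open Scope ring_scope.

(** Suppose every linear-sized vertex set contains a linear-sized set missing
    at most a proportion [e] of its pairs.  If some two linear-sized sets
    [X], [Y] miss at most [e/16] of the pairs between them, then gluing two
    such near-cliques of equal size, one inside [X] and one inside
    [Y], lowers [e] to [5e/8].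
    Iterating from the trivial [e = 1] proves the theorem, unless at some stage
    every pair of linear-sized sets has a proportion at least [c] of non-edges.
    In that case [H] embeds.  In a set [A] start from the pair [(A, A)], of
    density at least [d = beta(|A|/n)/2], and pass to subpairs as long as the
    density grows by a factor [1 + eta]; this stops after O(log(1/d)/eta)
    steps, at a pair [(V, B)] of density [D] none of whose subpairs, down to
    any prescribed function of its size, has density above [(1 + eta) D].
    Restricting [B] to vertices of typical degree, every [X] in [V] of
    proportion [6 eta] has density at least [D/2] to every subset of [B], even
    one tiny relative to [B].  So reserve [V] for one vertex of [H], embed the
    other vertices recursively inside [B], and choose the vertex of [V] last:
    since [eta] depends only on [d], [c] and [H], the tininess of the sets
    found inside [B] does no harm. *)

(** * Counting related pairs between two sets *)

Definition pairs (R : realType) (T : finType) (r : rel T) (X Y : {set T}) : R :=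
  \sum_(x in X) \sum_(y in Y) (r x y)%:R.
Arguments pairs {R T}.

(** The diagonal is excluded for both values of [b]: with [false] only genuine non-edges count, and
    vertices placed with prescribed relations are automatically distinct. *)
Definition drel (G : sgraph) (b : bool) : rel G :=
  fun x y => (x != y) && (adj x y == b).

Section Pairs.
Variables (R : realType) (T : finType).
Implicit Types (r : rel T) (X Y Z : {set T}).

Lemma sum_const_card X (c : R) : \sum_(x in X) c = c * #|X|%:R.
Proof. by rewrite sumr_const mulr_natr. Qed.

Lemma subset_cardR X Y : X \subset Y -> #|X|%:R <= #|Y|%:R :> R.
Proof. by move=> /subset_leq_card; rewrite ler_nat. Qed.

Lemma cardR_setD X Z : Z \subset X -> #|(X :\: Z)|%:R = #|X|%:R - #|Z|%:R :> R.
Proof.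
move=> sZX; rewrite cardsD (setIidPr sZX) natrB //; exact: subset_leq_card.
Qed.

Lemma pairs_ge0 r X Y : 0 <= pairs r X Y :> R.
Proof. by apply: sumr_ge0 => x _; apply: sumr_ge0. Qed.

Lemma row_le r x Y : \sum_(y in Y) (r x y)%:R <= #|Y|%:R :> R.
Proof.
by rewrite -[leRHS]mul1r -sum_const_card; apply: ler_sum => y _; case: r.
Qed.

Lemma row_card r x Y : \sum_(y in Y) (r x y)%:R = #|[set y in Y | r x y]|%:R :> R.
Proof.
rewrite -sum1_card natr_sum big_mkcond [RHS]big_mkcond /=.
by apply: eq_bigr => y _; rewrite inE; case: (y \in Y); case: (r x y).
Qed.

Lemma pairs_le r X Y : pairs r X Y <= #|X|%:R * #|Y|%:R :> R.
Proof.
rewrite mulrC -sum_const_card; apply: ler_sum => x _; exact: row_le.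
Qed.

Lemma pairs_symm r X Y : symmetric r -> pairs r X Y = pairs r Y X :> R.
Proof.
move=> sr; rewrite /pairs exchange_big /=.
by apply: eq_bigr => x _; apply: eq_bigr => y _; rewrite sr.
Qed.

Lemma pairsDl r X Y Z : Z \subset X ->
  pairs r X Y = pairs r Z Y + pairs r (X :\: Z) Y :> R.
Proof.
by move=> sZX; rewrite /pairs (big_setID Z) /= (setIidPr sZX).
Qed.

Lemma heavy_rows_bound r X Y (a : R) :
  a * #|[set x in X | a <= \sum_(y in Y) (r x y)%:R]|%:R <= pairs r X Y.
Proof.
rewrite -sum_const_card.
rewrite (@pairsDl r X Y [set x in X | a <= \sum_(y in Y) (r x y)%:R]); last first.
  by apply/subsetP => x; rewrite inE => /andP[].
rewrite -[leLHS]addr0 lerD ?pairs_ge0 //.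
by apply: ler_sum => x; rewrite inE => /andP[].
Qed.

Lemma pairs_le_heavy r X Y (a : R) : 0 <= a ->
  pairs r X Y <=
    #|[set x in X | a <= \sum_(y in Y) (r x y)%:R]|%:R * #|Y|%:R + a * #|X|%:R.
Proof.
move=> a0; set Z := [set x in X | _].
have sZX : Z \subset X by apply/subsetP => x; rewrite inE => /andP[].
rewrite (pairsDl _ _ sZX) lerD ?pairs_le //.
apply: (@le_trans _ _ (a * #|(X :\: Z)|%:R)); last first.
  by rewrite ler_wpM2l // subset_cardR // subsetDl.
rewrite -sum_const_card; apply: ler_sum => x.
by rewrite !inE negb_and => /andP[/orP[/negPf->//|]]; rewrite -ltNge => /ltW.
Qed.

Lemma light_columns_bound r X Y (a : R) : symmetric r -> (0 < #|Y|)%N ->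
  (forall y, y \in Y -> \sum_(x in X) (r y x)%:R < a) -> pairs r X Y < a * #|Y|%:R.
Proof.
move=> sr /card_gt0P[y0 y0Y] light; rewrite pairs_symm // -sum_const_card.
rewrite /pairs (bigD1 y0) //= [ltRHS](bigD1 y0) //=.
rewrite ltr_leD ?light //; apply: ler_sum => y /andP[yY _]; exact/ltW/light.
Qed.

(** Delete vertices of at least average degree one at a time. From size [t + 1] to [t] the count
    falls by a factor at most [(t - 1) / (t + 1)], and [(t - 1) (t + 1) <= t ^ 2] keeps the bound
    normalised by the square. *)
Lemma trim r (S : {set T}) (e : R) (M : nat) : symmetric r -> irreflexive r -> 0 <= e ->
  (0 < M <= #|S|)%N -> pairs r S S <= e * #|S|%:R ^+ 2 ->
  exists S' : {set T}, [/\ S' \subset S, #|S'| = M & pairs r S' S' <= e * M%:R ^+ 2].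
Proof.
move=> sr ir e0 /andP[M0]; move: {2}#|S| (erefl #|S|) => s.
elim: s S => [|s IH] S cS; first by rewrite cS leqNgt M0.
rewrite leq_eqVlt => /predU1P[-> le_e|]; first by exists S.
rewrite cS ltnS => leMs le_e.
have [x xS lex] : exists2 x, x \in S &
    pairs r S S <= (\sum_(y in S) (r x y)%:R) * #|S|%:R :> R.
  have [/exists_inP//|/exists_inPn small] :=
    boolP [exists x in S, pairs r S S <= (\sum_(y in S) (r x y)%:R) * #|S|%:R :> R].
  have S0 : (0 < #|S|)%N by rewrite cS.
  (* If every degree were below average, the total would be strictly smaller than itself. *)
  have := @light_columns_bound r S S (pairs r S S / #|S|%:R) sr S0.
  rewrite divfK ?pnatr_eq0 -?lt0n // ltxx => light.
  suff : is_true false by []; apply: light => y yS.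
  by have := small _ yS; rewrite -ltNge ltr_pdivlMr ?ltr0n.
have sx : [set x] \subset S by rewrite sub1set.
have cD : #|S :\ x| = s by move: (cardsD1 x S); rewrite xS cS => -[].
have [||S' [sS' cS' le']] := IH _ cD; first by rewrite cD.
  have eD : pairs r S S =
      2 * (\sum_(y in S) (r x y)%:R) + pairs r (S :\ x) (S :\ x) :> R.
    have eqx Y : pairs r [set x] Y = \sum_(y in Y) (r x y)%:R :> R.
      by rewrite /pairs big_set1.
    rewrite (pairsDl _ _ sx) (pairs_symm (S :\ x)) // (pairsDl _ _ sx) !eqx.
    rewrite addrA; congr (_ + _); rewrite mulr2n mulrDl mul1r; congr (_ + _).
    by rewrite [RHS](big_setD1 x) //= ir add0r.
  have P0 := pairs_ge0 r (S :\ x) (S :\ x).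
  rewrite cD; rewrite cS in lex le_e; set P := pairs r S S in eD lex le_e.
  have s1 : 1 <= s%:R :> R by rewrite ler1n; exact: leq_trans M0 leMs.
  rewrite -natr1 in lex le_e; move: lex le_e P0 s1 e0.
  move: (\sum_(y in S) _) (pairs _ (_ :\ _) _) (P) (s%:R : R) eD.
  move=> d Q p t -> lex le_e P0 s1 e0.
  have : (t + 1) * Q <= (t - 1) * (e * (t + 1) ^+ 2).
    apply: (@le_trans _ _ ((t - 1) * (2 * d + Q))); first by nra.
    by rewrite ler_wpM2l // subr_ge0.
  move=> h; have : Q <= (t - 1) * (e * (t + 1)).
    rewrite -(@ler_pM2l _ (t + 1)); last lra.
    by apply: (le_trans h); rewrite le_eqVlt; apply/orP; left; apply/eqP; ring.
  by nra.
by exists S'; split => //; exact: (subset_trans sS' (subsetDl _ _)).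
Qed.
End Pairs.

(** * Density increment and one-sided regularity *)

Section Regular.
Variable R : realType.

(** Induction on [J], the number of increments still affordable: a denser subpair spends one, and
    with none left the density would exceed 1. [Q t u] lets the size [u] at which regularity is
    tested depend on the size [t] of the pair; [tau] is fixed before the graph. *)
Lemma upper_regular_pair (eta : R) (Q : R -> R -> Prop) :
  0 < eta -> (forall t, 0 < t -> exists2 u, 0 < u & Q t u) ->
  forall (J : nat) (t D : R), 0 < t -> 0 < D -> 1 < (1 + eta) ^+ J * D ->
  exists2 tau, 0 < tau & forall (T : finType) (r : rel T) (V B : {set T}),
    (0 < #|T|)%N -> t * #|T|%:R <= #|V|%:R -> t * #|T|%:R <= #|B|%:R ->
    D * (#|V|%:R * #|B|%:R) <= pairs r V B ->
  exists V' B' : {set T}, exists t' u D' : R,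
    [/\ V' \subset V, B' \subset B, tau <= t', tau <= u & Q t' u] /\
    [/\ D <= D', t' * #|T|%:R <= #|V'|%:R, t' * #|T|%:R <= #|B'|%:R,
        D' * (#|V'|%:R * #|B'|%:R) <= pairs r V' B' &
        forall X Y : {set T}, X \subset V' -> Y \subset B' ->
          u * #|T|%:R <= #|X|%:R -> u * #|T|%:R <= #|Y|%:R ->
          pairs r X Y <= (1 + eta) * D' * (#|X|%:R * #|Y|%:R)].
Proof.
move=> eta0 HQ; elim=> [|J IH] t D t0 D0 DJ.
  exists 1 => // T r V B T0 tV tB; rewrite expr0 mul1r in DJ.
  have tT : 0 < t * #|T|%:R by rewrite mulr_gt0 // ltr0n.
  have VB : 0 < #|V|%:R * #|B|%:R :> R.
    by rewrite mulr_gt0 // (lt_le_trans tT).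
  move=> /le_trans /(_ (pairs_le _ _ _ _)).
  by rewrite -[leRHS]mul1r ler_pM2r // leNgt DJ.
have [u u0 Qtu] := HQ _ t0.
have [||tau tau0 Htau] := IH u ((1 + eta) * D) u0.
- by rewrite mulr_gt0 // addr_gt0.
- by rewrite mulrA -exprSr.
exists (Num.min tau (Num.min t u)) => [|T r V B T0 tV tB DVB].
  by rewrite !lt_min tau0 t0.
have [/existsP[X /existsP[Y /and5P[XV YB uX uY DXY]]]|/existsPn reg] :=
  boolP [exists X : {set T}, exists Y : {set T}, [&& X \subset V, Y \subset B,
    u * #|T|%:R <= #|X|%:R, u * #|T|%:R <= #|Y|%:R
    & (1 + eta) * D * (#|X|%:R * #|Y|%:R) <= pairs r X Y]].
  have [V' [B' [t' [u' [D' [[V'X B'Y tt' tu' Qt'] [DD' tV' tB' DV' regV']]]]]]]:=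
    Htau T r X Y T0 uX uY DXY.
  exists V', B', t', u', D'; split; split=> //.
  - exact: subset_trans XV.
  - exact: subset_trans YB.
  - by rewrite ge_min tt'.
  - by rewrite ge_min tu'.
  - by apply: le_trans DD'; rewrite mulrDl mul1r lerDl ltW // mulr_gt0.
exists V, B, t, u, D; split; split=> //; first by rewrite !ge_min lexx orbT.
  by rewrite !ge_min lexx !orbT.
move=> X Y XV YB uX uY; have /existsPn/(_ Y) := reg X.
by rewrite XV YB uX uY /= -ltNge => /ltW.
Qed.

(* Removing [X] from [V] cannot leave more than [(1 + eta) D] of density on the
   rest, so the lower bound on the degrees into [V] passes to [X]. *)
Lemma lower_regular (T : finType) (r : rel T) (V Y X : {set T}) (eta D a : R) :
  symmetric r -> 0 < eta <= 1 -> 0 < D -> X \subset V ->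
  a <= eta * D * #|V|%:R ->
  (forall y, y \in Y -> (1 - eta) * D * #|V|%:R <= \sum_(x in V) (r y x)%:R) ->
  (a <= #|V :\: X|%:R ->
     pairs r (V :\: X) Y <= (1 + eta) * D * (#|V :\: X|%:R * #|Y|%:R)) ->
  6 * eta * #|V|%:R <= #|X|%:R ->
  D / 2 * (#|X|%:R * #|Y|%:R) <= pairs r X Y.
Proof.
move=> sr /andP[eta0 eta1] D0 XV aD degY upper XV6.
have low : (1 - eta) * D * #|V|%:R * #|Y|%:R <= pairs r V Y.
  by rewrite pairs_symm // -sum_const_card; apply: ler_sum.
have cVX := cardR_setD R XV.
have up : pairs r (V :\: X) Y <=
   ((1 + eta) * D * #|V :\: X|%:R + eta * D * #|V|%:R) * #|Y|%:R.
  (* If [V :\: X] is too small for [upper], the trivial count of all pairs is absorbed by the term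
     [eta * D * #|V|]. *)
  rewrite mulrDl; have [/upper le1|/ltW le1] := leP a (#|V :\: X|%:R).
    by apply: (le_trans le1); rewrite mulrA lerDl !mulr_ge0 // ltW.
  rewrite -[leLHS]add0r lerD //; first by rewrite !mulr_ge0 ?addr_ge0 // ltW.
  apply: (le_trans (pairs_le _ _ _ _)); apply: ler_wpM2r => //.
  exact: le_trans le1 aD.
have XV' : #|X|%:R <= #|V|%:R :> R by apply: subset_cardR.
rewrite (pairsDl _ _ _ XV) in low; rewrite cVX in up.
(* This equals [D * ((1 + eta) * #|X| - 3 * eta * #|V|)], so the factor 6 in the size of [X] leaves
   at least [D / 2 * #|X|]. *)
pose gap := (1 - eta) * D * #|V|%:R
            - ((1 + eta) * D * (#|V|%:R - #|X|%:R) + eta * D * #|V|%:R).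
have : gap * #|Y|%:R <= pairs r X Y.
  by rewrite /gap mulrBl; lra.
apply: le_trans; rewrite mulrA; apply: ler_wpM2r => //.
have X0 : 0 <= #|X|%:R :> R by [].
rewrite -subr_ge0.
suff -> : gap - D / 2 * #|X|%:R =
    D * ((2^-1 + eta) * #|X|%:R - 3 * eta * #|V|%:R).
  apply: mulr_ge0; first exact: ltW.
  by have := mulr_ge0 (ltW eta0) X0; lra.
by rewrite /gap; field.
Qed.

End Regular.

(** * Edge density in terms of ordered pairs *)

Lemma set2_eq (T : finType) (x y a b : T) : [set a; b] = [set x; y] ->
  (a, b) = (x, y) \/ (a, b) = (y, x).
Proof.
move=> E; have := set21 a b; have := set22 a b; rewrite E !inE.
have := set21 x y; have := set22 x y; rewrite -E !inE.
move=> /orP[]/eqP-> /orP[]/eqP-> /orP[]/eqP e1 /orP[]/eqP e2; subst; by auto.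
Qed.

Lemma handshake (K : sgraph) :
  (\sum_(x : K) \sum_(y : K) adj x y = 2 * #|edges K|)%N.
Proof.
rewrite pair_big /=.
transitivity (\sum_(p : K * K | adj p.1 p.2) 1)%N.
  by rewrite [RHS]big_mkcond; apply: eq_bigr => p _; case: (adj _ _).
rewrite (partition_big (fun p => [set p.1; p.2]) (mem (edges K))) /=; last first.
  move=> [x y] /= xy; rewrite inE; apply/existsP; exists x.
  by apply/existsP; exists y; rewrite xy eqxx.
rewrite mulnC -sum_nat_const; apply: eq_bigr => e.
rewrite inE => /existsP[x /existsP[y /andP[xy /eqP->]]].
have nxy : x != y by apply: contraTneq xy => ->; rewrite adj_irrefl.
transitivity #|[set (x, y); (y, x)]|; last first.
  by rewrite cards2 xpair_eqE negb_and nxy.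
rewrite sum1dep_card; apply: eq_card => -[a b]; rewrite !inE /=.
apply/andP/orP => [[_ /eqP/set2_eq[]->]|]; rewrite ?eqxx; [by left|by right|].
by case=> /eqP[-> ->]; rewrite ?eqxx ?xy //; rewrite adj_sym xy setUC.
Qed.

Section Density.
Variable (R : realType).

Lemma drel_sym (G : sgraph) b : symmetric (@drel G b).
Proof. by move=> x y; rewrite /drel eq_sym adj_sym. Qed.

Lemma drel_irr (G : sgraph) b : irreflexive (@drel G b).
Proof. by move=> x; rewrite /drel eqxx. Qed.

Lemma pairs_compl (G : sgraph) (S : {set G}) :
  pairs (@drel G true) S S + pairs (@drel G false) S S = #|S|%:R * (#|S|%:R - 1) :> R.
Proof.
rewrite mulrC -sum_const_card /pairs -big_split; apply: eq_bigr => x xS.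
rewrite /= -big_split /= (big_setD1 x) //= !drel_irr !add0r.
have -> : #|S|%:R - 1 = #|S :\ x|%:R :> R.
  by rewrite (cardsD1 x S) xS natrD [_ + #|_|%:R]addrC addrK.
rewrite -[RHS]mul1r -sum_const_card; apply: eq_bigr => y.
rewrite !inE eq_sym => /andP[xy _]; rewrite /drel xy /=.
by case: (adj x y); rewrite ?addr0 ?add0r.
Qed.

Lemma edge_densityE (G : sgraph) (S : {set G}) : (1 < #|S|)%N ->
  edge_density R (induced S) * (#|S|%:R * (#|S|%:R - 1)) = pairs (@drel G true) S S.
Proof.
move=> S1.
have cS : #|induced S| = #|S| by rewrite /= card_sig; apply: eq_card => x; rewrite !inE.
have bin : #|S|%:R * (#|S|%:R - 1) = 2 * 'C(#|S|, 2)%:R :> R.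
  have := mul_bin_diag #|S| 1; rewrite bin1 => e.
  by rewrite -natrM -e natrM -subn1 natrB // ltnW.
rewrite /edge_density cS bin mulrCA divfK; last first.
  by rewrite pnatr_eq0 -lt0n bin_gt0.
rewrite -natrM -handshake natr_sum /pairs (@big_sub _ _ _ _ (mem S)).
apply: eq_bigr => x _; rewrite natr_sum (@big_sub _ _ _ _ (mem S)).
apply: eq_bigr => y _; rewrite /= /drel /induced_adj eqb_id.
rewrite -![sval _]/(val _).
by have [->|] := eqVneq (val x) (val y); rewrite ?adj_irrefl.
Qed.

Variable beta : R -> R.
Hypothesis beta_df : density_function beta.

Lemma dense_le (G : sgraph) m u : m <= u -> dense beta m G -> dense beta u G.
Proof.
move=> mu dG sigma /andP[us s1]; apply: dG; rewrite s1 andbT; exact: le_trans us.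
Qed.

(** Density is applied at the exact proportion [#|S| / #|G|], so nothing is rounded, and
    monotonicity brings it down to [s]. The hypotheses on [m] force [#|S| >= 2]; the factor 1/2 then
    pays for replacing [#|S| * (#|S| - 1)] by the square. *)
Lemma dense_pairs (G : sgraph) (S : {set G}) m s :
  1 <= m * #|G|%:R -> dense beta m G -> 0 < s <= 1 -> 2 * m <= s ->
  s * #|G|%:R <= #|S|%:R ->
  beta s / 2 * (#|S|%:R * #|S|%:R) <= pairs (@drel G true) S S.
Proof.
move=> mG dG /andP[s0 s1] ms sS.
have G0 : 0 < #|G|%:R :> R.
  by rewrite lt0r ler0n andbT; apply: contraTneq mG => ->; rewrite mulr0 ler10.
have S2 : 2 <= #|S|%:R :> R.
  apply: le_trans sS; apply: (@le_trans _ _ (2 * m * #|G|%:R)).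
    by rewrite -mulrA -[leLHS]mulr1 ler_pM2l.
  by rewrite ler_pM2r.
have S1 : (1 < #|S|)%N by rewrite ler_nat in S2.
have SG : #|S|%:R <= #|G|%:R :> R by rewrite ler_nat max_card.
rewrite -edge_densityE //.
set sg := #|S|%:R / #|G|%:R : R.
have ssg : s <= sg by rewrite ler_pdivlMr.
have sg1 : sg <= 1 by rewrite ler_pdivrMr // mul1r.
have d1 : beta sg <= edge_density R (induced S).
  apply: dG => //; last by rewrite divfK ?gt_eqF.
  rewrite sg1 andbT; apply: le_trans ssg; apply: le_trans ms.
  by have := lt_le_trans ltr01 mG; rewrite pmulr_lgt0 // => m0; lra.
have [bin bmono] := beta_df.
have sin : s \in `]0, 1] by rewrite in_itv /= s0.
have sgin : sg \in `]0, 1] by rewrite in_itv /= sg1 (lt_le_trans s0).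
have b0 : 0 < beta s by have := bin _ sin; rewrite in_itv /= => /andP[].
have bs : beta s <= edge_density R (induced S) by apply: le_trans d1; exact: bmono.
move: bs S2 b0; move: (edge_density _ _) (beta s) (#|S|%:R : R) => d b x bs S2 b0.
apply: (@le_trans _ _ (b * (x * (x - 1)))); last by rewrite ler_wpM2r //; nra.
by rewrite -mulrA ler_pM2l //; nra.
Qed.
End Density.

(** * Embedding vertex by vertex *)

Lemma exists_outside (R : realType) (T : finType) (V : {set T}) (h : nat)
    (bad : nat -> {set T}) (a : R) :
  (forall i, (i < h)%N -> #|bad i|%:R <= a) -> h%:R * a < #|V|%:R ->
  exists2 x, x \in V & forall i, (i < h)%N -> x \notin bad i.
Proof.
move=> bada hV.
have cU : #|\bigcup_(i < h) bad i|%:R <= h%:R * a.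
  apply: (@le_trans _ _ (\sum_(i < h) #|bad i|%:R)); last first.
    rewrite -[h in leRHS]card_ord mulr_natl -sumr_const.
    by apply: ler_sum => i _; exact: bada.
  rewrite -natr_sum ler_nat; elim/big_rec2: _ => [|i n A _ An].
    by rewrite cards0.
  by rewrite cardsU (leq_trans (leq_subr _ _)) // leq_add2l.
have /subsetPn[x xV xU] : ~~ (V \subset \bigcup_(i < h) bad i).
  apply: contraTN hV => /(@subset_cardR R) VU.
  by rewrite -leNgt (le_trans VU).
exists x => // i ih; apply: contra xU => xi.
by apply/bigcupP; exists (Ordinal ih).
Qed.

Lemma bernoulli_le (R : realType) (x : R) n : 0 <= x -> 1 + n%:R * x <= (1 + x) ^+ n.
Proof.
move=> x0; elim: n => [|n IH]; first by rewrite mul0r addr0.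
rewrite exprS; apply: (@le_trans _ _ ((1 + x) * (1 + n%:R * x))); last first.
  by rewrite ler_wpM2l // addr_ge0.
have nx : 0 <= n%:R * x * x by rewrite !mulr_ge0.
by rewrite -natr1; lra.
Qed.

Section Embedding.
Variables (R : realType) (beta : R -> R) (c : R) (h : nat) (P : nat -> nat -> bool).

Definition nonadj_rich (G : sgraph) (U : {set G}) (m : R) :=
  forall X Y : {set G}, X \subset U -> Y \subset U ->
    m * #|G|%:R <= #|X|%:R -> m * #|G|%:R <= #|Y|%:R ->
    c * (#|X|%:R * #|Y|%:R) <= pairs (@drel G false) X Y.

(** The two sizes are on different scales: [X] is relative to [W], while [Y] may be tiny. Each
    embedded vertex costs [W] a factor [g], so [g ^+ h] covers whatever remains of [W] during the
    whole embedding. *)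
Definition spread (G : sgraph) (W A : {set G}) (g m : R) :=
  forall (X Y : {set G}) b, X \subset W -> Y \subset A ->
    g ^+ h * #|W|%:R <= #|X|%:R -> m * #|G|%:R <= #|Y|%:R ->
    g * (#|X|%:R * #|Y|%:R) <= pairs (@drel G b) X Y.

(* [v 0, ..., v (k-1)] are embedded in [A]; the sets [W i], [k <= i < h],
   receive the later vertices, and the [W' i] are what remains of them. *)
Definition embeds (k : nat) (s m : R) :=
  forall (G : sgraph) (U A : {set G}) (W : nat -> {set G}) (g : nat -> R),
    1 <= m * #|G|%:R -> dense beta m G -> nonadj_rich U m ->
    A \subset U -> s * #|G|%:R <= #|A|%:R ->
    (forall i, (k <= i < h)%N -> 0 < g i <= 1 /\ spread (W i) A (g i) m) ->
    exists (v : nat -> G) (W' : nat -> {set G}),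
      [/\ forall i, (i < k)%N -> v i \in A,
          forall i j, (i < k)%N -> (j < i)%N -> drel (P i j) (v i) (v j)
        & forall i, (k <= i < h)%N ->
            [/\ W' i \subset W i, g i ^+ k * #|W i|%:R <= #|W' i|%:R
              & forall x j, x \in W' i -> (j < k)%N -> drel (P i j) x (v j)]].

Lemma embeds0 s : 0 < s -> embeds 0 s 1.
Proof.
move=> s0 G U A W g mG _ _ _ sA _.
have G0 : 0 < #|G|%:R :> R by rewrite mul1r in mG; exact: lt_le_trans mG.
have : 0 < #|A|%:R :> R by apply: lt_le_trans sA; rewrite mulr_gt0.
rewrite ltr0n => /card_gt0P[x xA].
(* No vertex is placed yet; [x] only provides a value for the function [v]. *)
by exists (fun=> x), W; split=> // i _; rewrite expr0 mul1r; split.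
Qed.

Lemma spreadW (G : sgraph) (W A B : {set G}) g m u :
  B \subset A -> m <= u -> spread W A g m -> spread W B g u.
Proof.
move=> BA mu sp X Y b XW YB gX uY; apply: sp => //.
  exact: subset_trans BA.
by apply: le_trans uY; rewrite ler_wpM2r.
Qed.

Lemma nonadj_richW (G : sgraph) (U : {set G}) m u :
  m <= u -> nonadj_rich U m -> nonadj_rich U u.
Proof.
move=> mu rich X Y XU YU uX uY.
by apply: rich => //; [apply: le_trans uX|apply: le_trans uY]; rewrite ler_wpM2r.
Qed.

Lemma embedsW k s m u : m <= u -> embeds k s u -> embeds k s m.
Proof.
move=> mu emb G U A W g mG dG rich AU sA spr; apply: (emb G U) => //.
- by apply: le_trans mG _; rewrite ler_wpM2r.
- exact: dense_le dG.
- exact: nonadj_richW rich.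
- by move=> i /spr[g01 sp]; split=> //; exact: spreadW sp.
Qed.

Hypothesis beta_df : density_function beta.
Hypothesis c01 : 0 < c <= 1.

(* [V'] is what remains of the candidate set of vertex [k]. *)
Lemma extend_embedding (G : sgraph) (A V' : {set G}) (W W' : nat -> {set G})
    (g : nat -> R) (k : nat) (m : R) :
  (k < h)%N -> 1 <= m * #|G|%:R ->
  (forall i, (k < i < h)%N -> 0 < g i <= 1 /\ spread (W i) A (g i) m) ->
  (forall i, (k < i < h)%N ->
     W' i \subset W i /\ g i ^+ k * #|W i|%:R <= #|W' i|%:R) ->
  V' \subset A -> h%:R * (m * #|G|%:R) < #|V'|%:R ->
  exists2 x, x \in V' & forall i, (k < i < h)%N ->
    g i ^+ k.+1 * #|W i|%:R <= #|[set y in W' i | drel (P i k) x y]|%:R.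
Proof.
move=> kh mG spr HW' VA big.
(* These candidates would shrink [W' i] too much. More than [m * #|G|] of them would contradict
   [spread] between [W' i] and [low i], so a union bound over [i] leaves a good candidate. *)
pose low i := [set x in V' | \sum_(y in W' i) (drel (P i k) x y)%:R
                              < g i * #|W' i|%:R].
pose bad i := if (k < i)%N then low i else set0.
have [|x xV good] := @exists_outside R G V' h bad (m * #|G|%:R) _ big.
  move=> i ih; rewrite /bad; case: ltnP => [ki|_]; last first.
    by rewrite cards0; apply: le_trans mG.
  have kih : (k < i < h)%N by rewrite ki.
  have [/andP[g0 g1] sp] := spr _ kih; have [WW gW] := HW' _ kih.
  rewrite leNgt; apply/negP => mlow.
  have low0 : (0 < #|low i|)%N.
    by rewrite -(ltr_nat R) (lt_trans _ mlow) // (lt_le_trans ltr01).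
  have lowA : low i \subset A.
    by apply: subset_trans VA; apply/subsetP => x; rewrite inE => /andP[].
  have := @light_columns_bound R G _ (W' i) (low i) _ (@drel_sym G (P i k)) low0.
  move=> /(_ (g i * #|W' i|%:R)) lt.
  have : g i * (#|W' i|%:R * #|low i|%:R) <= pairs (@drel G (P i k)) (W' i) (low i).
    apply: sp => //; last exact: ltW.
    apply: le_trans gW; apply: ler_wpM2r => //.
    by apply: ler_wiXn2l; [exact: ltW | | exact: ltnW].
  rewrite mulrA leNgt lt // => y; by rewrite inE => /andP[].
exists x => // i /andP[ki ih]; have kih : (k < i < h)%N by rewrite ki.
have [/andP[g0 g1] _] := spr _ kih; have [WW gW] := HW' _ kih.
rewrite -row_card; have := good i ih; rewrite /bad ki inE xV -leNgt /=.
by apply: le_trans; rewrite exprS -mulrA ler_pM2l.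
Qed.

(** The reserved set [V] joins the family [W] at index [k]. The induction hypothesis places the
    vertices below [k] in [B'] and shrinks all later sets, and vertex [k] is then picked from what
    is left of [V]. *)
Lemma embedsS k : (k < h)%N ->
  (forall s : R, 0 < s -> exists2 m : R, 0 < m & embeds k s m) ->
  forall s : R, 0 < s -> exists2 m : R, 0 < m & embeds k.+1 s m.
Proof.
move=> kh IH s s0; have [c0 c1] := andP c01.
(* For [s > 1] no set [A] is large enough; [beta] is controlled only up to 1. *)
have [s1|s1] := leP s 1; last first.
  exists 1 => // G U A W g mG _ _ _ sA _; exfalso.
  have G0 : 0 < #|G|%:R :> R by rewrite mul1r in mG; exact: lt_le_trans mG.
  have : #|A|%:R <= #|G|%:R :> R by rewrite ler_nat max_card.
  apply/negP; rewrite -ltNge; apply: lt_le_trans sA.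
  by rewrite -{1}[#|G|%:R]mul1r ltr_pM2r.
have /andP[b0 b1] : 0 < beta s <= 1.
  by have := beta_df.1 s; rewrite !in_itv /= s0 s1; apply.
pose d := beta s / 2; have d0 : 0 < d by rewrite divr_gt0.
have d1 : d <= 1 by rewrite /d; lra.
(* [d / 2] serves edges, through [lower_regular], and [c] serves non-edges, through
   [nonadj_rich]. *)
pose gV := Num.min (d / 2) c.
have gV0 : 0 < gV by rewrite lt_min divr_gt0.
have gV1 : gV <= 1 by rewrite ge_min c1 orbT.
(* Then [6 * eta] is exactly the proportion [gV ^+ h] demanded by [spread]. *)
pose eta : R := gV ^+ h / 6.
have gVh0 : 0 < gV ^+ h by rewrite exprn_gt0.
have gVh1 : gV ^+ h <= 1 by rewrite exprn_ile1 // ltW.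
have eta0 : 0 < eta by rewrite divr_gt0.
have eta1 : eta <= 1 by rewrite /eta; lra.
(* [eta * d * t] is the proportion of [G] guaranteed for [B'] below. The inequality on [u] also
   makes [u * #|G|] negligible, as [lower_regular] requires. *)
pose Q (t u : R) := u <= eta * d * t /\ embeds k (eta * d * t) u.
have HQ t : 0 < t -> exists2 u, 0 < u & Q t u.
  move=> t0; have t'0 : 0 < eta * d * t by exact: mulr_gt0 (mulr_gt0 eta0 d0) t0.
  have [u u0 emb] := IH _ t'0.
  exists (Num.min u (eta * d * t)); first by rewrite lt_min u0.
  split; first by rewrite ge_min lexx orbT.
  by apply: embedsW emb; rewrite ge_min lexx.
have [J HJ] : exists J : nat, 1 < (1 + eta) ^+ J * d.
  have x0 : 0 <= (d * eta)^-1 by rewrite invr_ge0 ltW // mulr_gt0.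
  exists (Num.bound (d * eta)^-1); rewrite -ltr_pdivrMr //.
  apply: lt_le_trans (bernoulli_le _ (ltW eta0)).
  apply: (@lt_trans _ _ ((Num.bound (d * eta)^-1)%:R * eta)); last by rewrite ltrDr.
  by rewrite -ltr_pdivrMr // div1r -invfM archi_boundP.
have [tau tau0 Htau] := upper_regular_pair eta0 HQ s0 d0 HJ.
(* The three bounds serve [dense_pairs], the comparison [m <= u], and the final choice of a vertex
   in [V]; there [h.+1] instead of [h] gives a strict inequality. *)
pose m := Num.min (s / 2) (Num.min tau (gV ^+ h * tau / h.+1%:R)).
have m0 : 0 < m by rewrite !lt_min tau0 !divr_gt0 // mulr_gt0.
have ms : 2 * m <= s.
  have : m <= s / 2 by rewrite ge_min lexx.
  by lra.
have mtau : m <= tau by rewrite !ge_min lexx orbT.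
have mh : h.+1%:R * m <= gV ^+ h * tau.
  by rewrite mulrC -ler_pdivlMr ?ltr0n // !ge_min lexx !orbT.
exists m => // G U A W g mG dG rich AU sA spr.
have G0 : 0 < #|G|%:R :> R by have := lt_le_trans ltr01 mG; rewrite pmulr_rgt0.
have s01 : 0 < s <= 1 by rewrite s0.
have dA := dense_pairs beta_df mG dG s01 ms sA.
have G0n : (0 < #|G|)%N by rewrite -(ltr_nat R).
have [V [B [t [u [D [[VA BA taut tauu [ud emb]] [dD tV tB DV reg]]]]]]] :=
  Htau _ _ A A G0n sA sA dA.
have D0 : 0 < D by exact: lt_le_trans dD.
have t0 : 0 < t by exact: lt_le_trans taut.
have mu : m <= u by exact: le_trans tauu.
have mGu : 1 <= u * #|G|%:R by apply: le_trans mG _; rewrite ler_pM2r.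
have V0 : 0 < #|V|%:R :> R by apply: lt_le_trans tV; rewrite mulr_gt0.
have mV : h.+1%:R * (m * #|G|%:R) <= gV ^+ h * #|V|%:R.
  rewrite mulrA; apply: (@le_trans _ _ (gV ^+ h * tau * #|G|%:R)).
    by rewrite ler_pM2r.
  rewrite -mulrA ler_pM2l //; apply: le_trans tV; by rewrite ler_pM2r.
pose B' := [set y in B | (1 - eta) * D * #|V|%:R <= \sum_(x in V) (drel true y x)%:R].
have B'B : B' \subset B by apply/subsetP => y; rewrite inE => /andP[].
(* Rows outside [B'] carry at most [(1 - eta) * D * #|V| * #|B|] pairs. The remaining
   [eta * D * #|V| * #|B|] lie in rows of length [#|V|], hence [#|B'| >= eta * D * #|B|]. *)
have B'big : eta * d * t * #|G|%:R <= #|B'|%:R.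
  have a0 : 0 <= (1 - eta) * D * #|V|%:R by rewrite !mulr_ge0 ?subr_ge0 // ltW.
  have := pairs_le_heavy (@drel G true) B V a0; rewrite -/B'.
  rewrite (pairs_symm _ B V (@drel_sym G true)) => /(le_trans DV) le1.
  have {}le1 : eta * D * #|B|%:R <= #|B'|%:R.
    by rewrite -(ler_pM2r V0); lra.
  apply: le_trans le1; rewrite -mulrA.
  apply: (@le_trans _ _ (eta * d * #|B|%:R)).
    by rewrite ler_wpM2l // mulr_ge0 // ltW.
  by rewrite ler_wpM2r // ler_wpM2l // ltW.
have VU : V \subset U by exact: subset_trans AU.
have B'A : B' \subset A by exact: subset_trans BA.
have spV : spread V B' gV u.
  move=> X Y [] XV YB' gX uY.
    apply: (@le_trans _ _ (D / 2 * (#|X|%:R * #|Y|%:R))).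
      rewrite ler_wpM2r ?mulr_ge0 // ge_min; apply/orP; left.
      by rewrite ler_pM2r // invr_gt0.
    apply: (@lower_regular _ _ _ V Y X eta D (u * #|G|%:R)) => //.
    - exact: drel_sym.
    - by rewrite eta0.
    - apply: (@le_trans _ _ (eta * d * (t * #|G|%:R))).
        by rewrite mulrA ler_pM2r.
      apply: ler_pM => //; last by rewrite ler_pM2l.
        exact: ltW (mulr_gt0 eta0 d0).
      exact: ltW (mulr_gt0 t0 G0).
    - by move=> y /(subsetP YB'); rewrite inE => /andP[].
    - move=> uX; apply: reg => //; first exact: subsetDl.
      exact: subset_trans YB' B'B.
    - by have -> : 6 * eta = gV ^+ h by rewrite /eta; field.
  apply: (@le_trans _ _ (c * (#|X|%:R * #|Y|%:R))).
    by rewrite ler_wpM2r ?mulr_ge0 // ge_min lexx orbT.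
  apply: rich => //.
  - exact: subset_trans VU.
  - exact: subset_trans (subset_trans YB' B'A) AU.
  - apply: le_trans gX; apply: le_trans mV; rewrite -[leLHS]mul1r.
    by rewrite ler_pM2r ?ler1n // mulr_gt0.
  - by apply: le_trans uY; rewrite ler_pM2r.
pose W2 i := if i == k then V else W i.
pose g2 i := if i == k then gV else g i.
have [||||||v [W' [vB vP HW']]] := emb G U B' W2 g2 => //.
- exact: dense_le dG.
- exact: nonadj_richW rich.
- exact: subset_trans AU.
- move=> i /andP[ki ih]; rewrite /W2 /g2; case: eqVneq => [_|ik].
    by rewrite gV0.
  have kih : (k.+1 <= i < h)%N by rewrite ltn_neqAle eq_sym ik ki.
  by have [g01 sp] := spr _ kih; split=> //; exact: spreadW sp.
have HW i : (k < i < h)%N ->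
    [/\ W' i \subset W i, g i ^+ k * #|W i|%:R <= #|W' i|%:R
      & forall x j, x \in W' i -> (j < k)%N -> drel (P i j) x (v j)].
  move=> /andP[ki ih]; have := HW' i; rewrite (ltnW ki) ih /W2 /g2.
  by rewrite gtn_eqF //; apply.
have [W'V gW' W'P] : [/\ W' k \subset V, gV ^+ k * #|V|%:R <= #|W' k|%:R
              & forall x j, x \in W' k -> (j < k)%N -> drel (P k j) x (v j)].
  by have := HW' k; rewrite leqnn kh /W2 /g2 eqxx; apply.
have W'A : W' k \subset A by exact: subset_trans VA.
have [|||x xW' good] := @extend_embedding G A (W' k) W W' g k m kh mG spr => //.
- by move=> i /HW[].
- apply: lt_le_trans gW'; apply: (@lt_le_trans _ _ (gV ^+ h * #|V|%:R)).
    apply: lt_le_trans mV; rewrite ltr_pM2r ?ltr_nat //; exact: mulr_gt0.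
  rewrite ler_pM2r //; apply: ler_wiXn2l; [exact: ltW|done|exact: ltnW].
exists (fun i => if i == k then x else v i).
exists (fun i => [set y in W' i | drel (P i k) x y]); split.
- move=> i; rewrite ltnS leq_eqVlt; case: eqVneq => [_ _|_ /= ik].
    exact: (subsetP W'A).
  exact: (subsetP B'A) (vB _ ik).
- move=> i j; rewrite ltnS leq_eqVlt; case: eqVneq => [-> _ jk|_ /= ik ji].
    by rewrite ltn_eqF //; exact: W'P.
  by rewrite ltn_eqF ?(ltn_trans ji) //; exact: vP.
- move=> i kih; have [W'W gW'i W'iP] := HW i kih; split.
  + by apply: subset_trans W'W; apply/subsetP => y; rewrite inE => /andP[].
  + exact: good.
  + move=> y j; rewrite inE => /andP[yW' xy]; rewrite ltnS leq_eqVlt.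
    by case: eqVneq => [-> _|_ /= jk]; [rewrite drel_sym|exact: W'iP].
Qed.

End Embedding.

(** * From an embedding to an induced copy *)

Definition pattern (H : sgraph) (i j : nat) : bool :=
  [exists a : H, [exists b : H,
    [&& enum_rank a == i :> nat, enum_rank b == j :> nat & adj a b]]].

Lemma pattern_rank (H : sgraph) (a b : H) : pattern H (enum_rank a) (enum_rank b) = adj a b.
Proof.
apply/existsP/idP => [[a' /existsP[b' /and3P[/eqP ra /eqP rb ab]]]|ab].
  by move: ab; rewrite (enum_rank_inj (val_inj ra)) (enum_rank_inj (val_inj rb)).
by exists a; apply/existsP; exists b; rewrite !eqxx.
Qed.

(** Symmetry supplies the relations for the other order of indices, and the distinctness inside
    [drel] makes [f] injective; its image is the forbidden vertex set. *)
Lemma copy_not_free (G H : sgraph) (v : nat -> G) :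
  (forall i j, (i < #|H|)%N -> (j < i)%N -> drel (pattern H i j) (v i) (v j)) ->
  ~ induced_free H G.
Proof.
move=> vP; pose f (a : H) := v (enum_rank a).
have fP a b : a != b -> drel (adj a b) (f a) (f b).
  wlog lt : a b / (enum_rank b < enum_rank a)%N => [W|] ab.
    have : enum_rank a != enum_rank b :> nat.
      by apply: contra ab => /eqP/val_inj/enum_rank_inj->.
    rewrite neq_ltn => /orP[] lt; last exact: W.
    by rewrite drel_sym adj_sym; apply: W; rewrite 1?eq_sym.
  by rewrite -pattern_rank; apply: vP.
have f_inj : injective f.
  move=> a b fab; apply/eqP; apply: contraT => /fP.
  by rewrite /drel fab eqxx.
have fadj a b : adj (f a) (f b) = adj a b.
  have [->|/fP/andP[_ /eqP//]] := eqVneq a b; by rewrite !adj_irrefl.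
have fS a : f a \in f @: [set: H] by rewrite imset_f.
move=> /(_ (f @: [set: H])); apply.
pose g (a : H) : induced (f @: [set: H]) := exist _ (f a) (fS a).
have [g' gK g'K] : bijective g.
  apply: inj_card_bij => [a b [/f_inj]//|].
  by rewrite /= card_sig -cardsT -(card_imset _ f_inj); apply/subset_leq_card/subsetP.
exists g'; first by exists g.
by move=> x y; rewrite -{2}[x]g'K -{2}[y]g'K /= /induced_adj /= fadj.
Qed.

(** * Building and improving near-cliques *)

Section NearClique.
Variables (R : realType) (beta : R -> R) (H : sgraph).
Hypothesis beta_df : density_function beta.

(* [1 <= t * #|G|] says that [G] is large in terms of [t]. *)
Definition near_clique (e : R) :=
  forall s : R, 0 < s -> exists2 t : R, 0 < t &
    forall (G : sgraph) (U : {set G}), 1 <= t * #|G|%:R ->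
      dense beta t G -> induced_free H G -> s * #|G|%:R <= #|U|%:R ->
      exists S : {set G}, [/\ S \subset U, t * #|G|%:R <= #|S|%:R
        & pairs (@drel G false) S S <= e * #|S|%:R ^+ 2].

Lemma near_clique1 : near_clique 1.
Proof.
move=> s s0; exists s => // G U _ _ _ sU; exists U; split=> //.
by rewrite mul1r; exact: pairs_le.
Qed.

Lemma embed_nonadj_rich (c s : R) : 0 < c <= 1 -> 0 < s ->
  exists2 m : R, 0 < m & forall (G : sgraph) (U : {set G}),
    1 <= m * #|G|%:R -> dense beta m G -> s * #|G|%:R <= #|U|%:R ->
    nonadj_rich c U m -> ~ induced_free H G.
Proof.
move=> c01 s0; set h := #|H|.
have emb k : (k <= h)%N -> forall s : R, 0 < s ->
    exists2 m : R, 0 < m & embeds beta c h (pattern H) k s m.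
  elim: k => [_ s' s'0|k IH kh]; first by exists 1 => //; exact: embeds0.
  by apply: embedsS => //; apply: IH; exact: ltnW.
have [m m0 embm] := emb h (leqnn h) s s0.
exists m => // G U mG dG sU rich.
(* With [k = h] there are no later vertices, so the sets and proportions supplied are dummies. *)
have [|v [W' [_ vP _]]] :=
    embm G U U (fun=> set0) (fun=> 1) mG dG rich (subxx U) sU.
  by move=> i /andP[hi]; rewrite ltnNge hi.
exact: copy_not_free vP.
Qed.

Lemma light_rows (T : finType) (r : rel T) (X Y : {set T}) (a : R) : 0 < a ->
  (0 < #|Y|)%N -> pairs r X Y <= a * (#|X|%:R * #|Y|%:R) ->
  exists X' : {set T}, [/\ X' \subset X, #|X|%:R / 2 <= #|X'|%:R :> R
    & forall x, x \in X' -> \sum_(y in Y) (r x y)%:R <= 2 * a * #|Y|%:R].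
Proof.
move=> a0 Y0 le_a; have Y0R : 0 < #|Y|%:R :> R by rewrite ltr0n.
have heavy := heavy_rows_bound r X Y (2 * a * #|Y|%:R).
set Z := [set x in X | _] in heavy.
have ZX : Z \subset X by apply/subsetP => x; rewrite inE => /andP[].
exists (X :\: Z); split; first exact: subsetDl.
  have := le_trans heavy le_a.
  rewrite cardR_setD // -[2 * a * _]mulrA [2 * _]mulrC -mulrA [a * _ * _]mulrAC.
  move=> le1; have : 2 * #|Z|%:R <= #|X|%:R :> R.
    by rewrite -(ler_pM2r Y0R) -(ler_pM2l a0); lra.
  by lra.
move=> x; rewrite !inE negb_and => /andP[/orP[/negPf->//|]].
by rewrite -ltNge => /ltW.
Qed.

(** Keeping light rows doubles the cross bound twice, from [e / 16] to [e / 8] and then [e / 4]. Two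
    near-cliques of size [M] thus miss at most [e + 2 * (e / 4) + e = 5 / 2 * e] times [M ^ 2],
    which is [5 / 8 * e] times [(2 * M) ^ 2]. *)
Lemma join_near_cliques (G : sgraph) (X Y : {set G}) (e m t : R) :
  0 < e -> 0 < m -> 0 < t <= m / 4 -> 1 <= t * #|G|%:R ->
  (forall U : {set G}, m / 4 * #|G|%:R <= #|U|%:R ->
     exists S : {set G}, [/\ S \subset U, t * #|G|%:R <= #|S|%:R
       & pairs (@drel G false) S S <= e * #|S|%:R ^+ 2]) ->
  m * #|G|%:R <= #|X|%:R -> m * #|G|%:R <= #|Y|%:R ->
  pairs (@drel G false) X Y <= e / 16 * (#|X|%:R * #|Y|%:R) ->
  exists S : {set G}, [/\ S \subset X :|: Y, t * #|G|%:R <= #|S|%:R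
    & pairs (@drel G false) S S <= 5 / 8 * e * #|S|%:R ^+ 2].
Proof.
move=> e0 m0 /andP[t0 tm] tG near mX mY le_XY.
set r := @drel G false in near le_XY *.
have G0 : 0 < #|G|%:R :> R by have := lt_le_trans ltr01 tG; rewrite pmulr_rgt0.
have mG : 0 < m * #|G|%:R by rewrite mulr_gt0.
have tmG : t * #|G|%:R <= m / 4 * #|G|%:R by rewrite ler_pM2r.
have e160 : 0 < e / 16 by rewrite divr_gt0.
(* A common size for both near-cliques. As [M >= 1], the union has [2 * M >= M + 1 > t * #|G|]
   vertices, which repairs the rounding. *)
pose M := Num.truncn (t * #|G|%:R).
have M0 : (0 < M)%N by rewrite truncn_gt0.
have /andP[Mt tM] : M%:R <= t * #|G|%:R < M.+1%:R by rewrite truncn_itv // ltW // mulr_gt0.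
have M1 : 1 <= M%:R :> R by rewrite ler1n.
have near_M (Z : {set G}) : m / 4 * #|G|%:R <= #|Z|%:R -> exists S : {set G},
    [/\ S \subset Z, #|S| = M & pairs r S S <= e * M%:R ^+ 2].
  move=> /near[S0 [S0Z tS0 le_S0]].
  have MS0 : (0 < M <= #|S0|)%N.
    by rewrite M0 -(ler_nat R); exact: le_trans tS0.
  have [S [SS0 cS leS]] := trim (@drel_sym G false) (@drel_irr G false) (ltW e0) MS0 le_S0.
  by exists S; split=> //; exact: subset_trans S0Z.
have Y0 : (0 < #|Y|)%N by rewrite -(ltr_nat R); exact: lt_le_trans mY.
have [X1 [X1X cX1 X1deg]] := light_rows e160 Y0 le_XY.
have [|S1 [S1X1 cS1 leS1]] := near_M X1; first by lra.
have le_Y : pairs r Y S1 <= e / 8 * (#|Y|%:R * #|S1|%:R).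
  rewrite (pairs_symm _ _ _ (@drel_sym G false)) mulrA -sum_const_card.
  apply: ler_sum => x /(subsetP S1X1)/X1deg => le1; apply: le_trans le1 _.
  by rewrite [leRHS](_ : _ = 2 * (e / 16) * #|Y|%:R) //; field.
have e80 : 0 < e / 8 by rewrite divr_gt0.
have S10 : (0 < #|S1|)%N by rewrite cS1.
have [Y1 [Y1Y cY1 Y1deg]] := light_rows e80 S10 le_Y.
(* [X] and [Y] may overlap, so [S1] is removed first: at least [m / 2 - m / 4] of [G] is left. *)
have [|S2 [S2Y1 cS2 leS2]] := near_M (Y1 :\: S1).
  have cD : #|Y1|%:R - #|S1|%:R <= #|Y1 :\: S1|%:R :> R.
    rewrite lerBlDr -natrD ler_nat -(cardsID S1 Y1) addnC leq_add2l.
    exact/subset_leq_card/subsetIr.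
  by apply: le_trans cD; rewrite cS1; lra.
have dS : [disjoint S1 & S2].
  rewrite disjoint_sym disjoints_subset; apply/subsetP => x /(subsetP S2Y1).
  by rewrite !inE => /andP[].
have le_cross : pairs r S2 S1 <= e / 4 * M%:R ^+ 2.
  rewrite expr2 mulrA -[X in _ * X](congr1 (fun n => n%:R) cS2) -sum_const_card.
  apply: ler_sum => x /(subsetP S2Y1); rewrite inE => /andP[_ /Y1deg le1].
  by rewrite cS1 in le1; apply: le_trans le1 _; lra.
have cS : #|S1 :|: S2|%:R = 2 * M%:R :> R.
  by rewrite cardsU (disjoint_setI0 dS) cards0 subn0 cS1 cS2 natrD; ring.
exists (S1 :|: S2); split.
- apply/subsetP => x; rewrite !inE => /orP[/(subsetP S1X1)/(subsetP X1X)->//|].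
  by move=> /(subsetP S2Y1); rewrite inE => /andP[_ /(subsetP Y1Y)->]; rewrite orbT.
- by rewrite cS; move: tM; rewrite -natr1; lra.
have S1S : S1 \subset S1 :|: S2 by exact: subsetUl.
have DS : (S1 :|: S2) :\: S1 = S2.
  by rewrite setDUl setDv set0U; apply/setDidPl; rewrite disjoint_sym.
rewrite cS.
suff -> : pairs r (S1 :|: S2) (S1 :|: S2) =
    pairs r S1 S1 + 2 * pairs r S2 S1 + pairs r S2 S2 :> R.
  by lra.
have sr : symmetric r by exact: drel_sym.
rewrite (pairsDl _ _ _ S1S) DS (pairs_symm _ S1) // (pairs_symm _ S2 (_ :|: _)) //.
rewrite !(pairsDl _ _ _ S1S) DS (pairs_symm _ S1 S2) //; ring.
Qed.

(** If [U] contains no improved near-clique, no two large subsets can be joined, so [U] is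
    [nonadj_rich] with [c = e / 16] and [H] embeds. *)
Lemma near_clique_step (e : R) : 0 < e <= 1 -> near_clique e -> near_clique (5 / 8 * e).
Proof.
move=> /andP[e0 e1] near s s0.
have c01 : 0 < e / 16 <= 1 by apply/andP; split; lra.
have [m m0 emb] := embed_nonadj_rich c01 s0.
have m40 : 0 < m / 4 by rewrite divr_gt0.
have [t t0 near_t] := near _ m40.
pose u := Num.min t (m / 4); have u0 : 0 < u by rewrite lt_min t0.
have ut : u <= t by rewrite ge_min lexx.
have um4 : u <= m / 4 by rewrite ge_min lexx orbT.
have um : u <= m by lra.
exists u => // G U uG dG freeG sU.
have scale a : u <= a -> 1 <= a * #|G|%:R.
  by move=> ua; apply: le_trans uG _; rewrite ler_wpM2r.
have [/existsP[S /and3P[SU uS leS]]|/existsPn noS] := boolP [exists S : {set G},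
  [&& S \subset U, u * #|G|%:R <= #|S|%:R
    & pairs (@drel G false) S S <= 5 / 8 * e * #|S|%:R ^+ 2]]; first by exists S.
case: (emb G U (scale _ um) (dense_le um dG) sU) => // X Y XU YU mX mY.
rewrite leNgt; apply/negP => /ltW le_XY.
have near_u (Z : {set G}) : m / 4 * #|G|%:R <= #|Z|%:R -> exists S : {set G},
    [/\ S \subset Z, u * #|G|%:R <= #|S|%:R
      & pairs (@drel G false) S S <= e * #|S|%:R ^+ 2].
  move=> /(near_t G Z (scale _ ut) (dense_le ut dG) freeG)[S [SZ tS leS]].
  by exists S; split=> //; apply: le_trans tS; rewrite ler_wpM2r.
have u01 : 0 < u <= m / 4 by rewrite u0.
have [S [SXY uS leS]] := join_near_cliques e0 m0 u01 uG near_u mX mY le_XY.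
have := noS S; rewrite uS leS (subset_trans SXY) // subUset XU.
exact: YU.
Qed.

Lemma near_clique_all (e : R) : 0 < e -> near_clique e.
Proof.
move=> e0.
have pow k : near_clique ((5 / 8) ^+ k).
  elim: k => [|k IH]; first by rewrite expr0; exact: near_clique1.
  rewrite exprS; apply: near_clique_step => //.
  by rewrite exprn_gt0 //= ?exprn_ile1 //; lra.
have [k le_k] : exists k, (5 / 8) ^+ k <= e.
  have x0 : 0 <= 2 / e by rewrite divr_ge0 // ltW.
  (* Bernoulli for [8 / 5 = 1 + 3 / 5]: since [e * n > 2], the product [e * (1 + 3 * n / 5)] exceeds
     1. *)
  exists (Num.bound (2 / e)); set n := Num.bound _.
  have eq85 : (1 + 3 / 5 : R) = (5 / 8)^-1 by field.
  have n1 : 1 + n%:R * (3 / 5) <= (5 / 8 : R)^-1 ^+ n.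
    by rewrite -eq85; apply: bernoulli_le; lra.
  have n2 : 2 < e * n%:R by rewrite mulrC -ltr_pdivrMr //; exact: archi_boundP.
  have p0 : 0 < (5 / 8 : R) ^+ n by rewrite exprn_gt0 //; lra.
  rewrite -(ler_pM2r (_ : 0 < ((5 / 8 : R) ^+ n)^-1)) ?invr_gt0 // divff ?gt_eqF //.
  rewrite -exprVn; apply: (@le_trans _ _ (e * (1 + n%:R * (3 / 5)))).
    by rewrite mulrDr mulrA; lra.
  by rewrite ler_pM2l.
move=> s /(pow k)[t t0 near]; exists t => // G U tG dG fG sU.
have [S [SU tS leS]] := near G U tG dG fG sU; exists S; split => //.
by apply: le_trans leS _; rewrite ler_wpM2r // exprn_ge0.
Qed.

End NearClique.

(** * Conclusion: large graphs by near-cliques, small graphs by a single edge *)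

Theorem theorem8p1 (R : realType) (beta : R -> R) (epsilon : R) (H : sgraph) :
  density_function beta -> 0 < epsilon ->
  exists2 delta : R, 0 < delta <= 1 &
    forall G : sgraph, (1 < #|G|)%N ->
      dense beta delta G -> induced_free H G ->
      exists S : {set G},
        [/\ (1 < #|S|)%N,
            delta * #|G|%:R <= #|S|%:R
          & 1 - epsilon <= edge_density R (induced S)].
Proof.
move=> beta_df eps0.
(* The half pays for [#|S| ^ 2 <= 2 * #|S| * (#|S| - 1)]. *)
have e0 : 0 < epsilon / 2 by rewrite divr_gt0.
have [t t0 near] := near_clique_all H beta_df e0 ltr01.
(* With [delta <= t / 2], a graph with [delta * #|G| >= 1] yields a near-clique of at least two
   vertices. *)
pose delta := Num.min (t / 2) 1.
have d0 : 0 < delta by rewrite lt_min divr_gt0 //= ltr01.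
have dt : 2 * delta <= t.
  by have : delta <= t / 2; [rewrite ge_min lexx|lra].
have d1 : delta <= 1 by rewrite ge_min lexx orbT.
exists delta => [|G G1 dG fG]; first by rewrite d0.
have G0 : 0 < #|G|%:R :> R by rewrite ltr0n ltnW.
have [dG1|/ltW dG1] := leP 1 (delta * #|G|%:R).
  have tG2 : 2 <= t * #|G|%:R.
    apply: (@le_trans _ _ (2 * delta * #|G|%:R)); last by rewrite ler_pM2r.
    by rewrite -mulrA ler_peMr.
  have [|||S [_ tS leS]] := near G setT _ _ fG.
  - by apply: le_trans tG2; rewrite ler1n.
  - by apply: dense_le dG; lra.
  - by rewrite mul1r cardsT.
  have S2 : 2 <= #|S|%:R :> R by exact: le_trans tS.
  have S1 : (1 < #|S|)%N by rewrite ler_nat in S2.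
  exists S; split=> //.
    by apply: le_trans tS; rewrite ler_pM2r //; lra.
  have := edge_densityE R S1; have := pairs_compl R S; move: leS S2.
  move: (#|S|%:R : R) (pairs _ _ _) (pairs _ _ _) (edge_density _ _) => x p q d.
  move=> le_p x2 pq dq.
  have xx0 : 0 < x * (x - 1) by rewrite mulr_gt0; lra.
  rewrite -(ler_pM2r xx0) dq.
  have x1 : x <= 2 * (x - 1) by lra.
  have : epsilon / 2 * x ^+ 2 <= epsilon * (x * (x - 1)).
    rewrite [leRHS](_ : _ = epsilon / 2 * (x * (2 * (x - 1)))); last by field.
    by rewrite ler_pM2l // expr2 ler_pM2l //; lra.
  by lra.
(* Here [delta * #|G|] is below 1, so the two ends of any edge suffice. An edge exists because
   density at [sigma = 1] is at least [beta 1 > 0]. *)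
have S0 : #|[set: G]|%:R = 1 * #|G|%:R :> R by rewrite cardsT mul1r.
have b0 : 0 < beta 1.
  by have := beta_df.1 1; rewrite in_itv /= ltr01 lexx => /(_ isT)/andP[].
have d11 : delta <= 1 <= (1 : R) by rewrite d1 lexx.
have S1 : (1 < #|[set: G]|)%N by rewrite cardsT.
have := lt_le_trans b0 (dG 1 d11 setT S1 S0).
have [/existsP[x /existsP[y xy]] _|/existsPn no] :=
  boolP
  [exists x : G, [exists y, adj x y]].
  have nxy : x != y by apply: contraTneq xy => ->; rewrite adj_irrefl.
  have c2 : #|[set x; y]| = 2%N by rewrite cards2 nxy.
  have S21 : (1 < #|[set x; y]|)%N by rewrite c2.
  exists [set x; y]; split=> //; first by rewrite c2 (le_trans dG1) // ler1n.
  have := edge_densityE R S21; rewrite c2 /pairs.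
  have dxy : drel true x y by rewrite /drel nxy xy.
  have dyx : drel true y x by rewrite drel_sym.
  rewrite big_setU1 ?inE //= big_set1 !big_setU1 ?inE //= !big_set1 !drel_irr dxy dyx /=.
  by lra.
have := edge_densityE R S1; rewrite /pairs big1 => [/eqP|x _].
  rewrite mulf_eq0 => /orP[/eqP->|]; first by rewrite ltxx.
  rewrite S0 mul1r mulf_eq0 subr_eq0 pnatr_eq0 pnatr_eq1.
  by case/orP=> /eqP G_eq; rewrite G_eq in G1.
rewrite big1 // => y _; rewrite /drel eqb_id.
by have /existsPn/(_ y)/negPf-> := no x; rewrite andbF.
Qed.
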